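(* Let $X_1,\dots,X_n$ be independent random variables with $X_i\sim W\text{-}Exp(\alpha,\beta,\gamma_i)$, $i=1,\dots,n$, and let $Y_1,\dots,Y_n$ be independent random variables with $Y_i\sim W\text{-}Exp(\alpha,\beta,\gamma_i^* )$, $i=1,\dots,n$ (all parameters positive). Write $\underline\gamma=(\gamma_1,\dots,\gamma_n)$ and $\underline\gamma^*=(\gamma_1^*,\dots,\gamma_n^* )$. If $\underline\gamma\prec^{w}\underline\gamma^*$, then $X_{n:n}\le_{st}Y_{n:n}$.
   Context: For $\alpha,\beta,\gamma>0$, $X\sim W\text{-}Exp(\alpha,\beta,\gamma)$ (the Weibull-G distribution with exponential baseline $F(\gamma x)=1-e^{-\gamma x}$) means that $X$ has cdf $1-e^{-\alpha(e^{\gamma x}-1)^{\beta}}$ for $x>0$ (and $0$ for $x\le0$). $X_{n:n}=\max(X_1,\dots,X_n)$, and similarly for $Y_{n:n}$. Usual stochastic order: $X\le_{st}Y$ iff $P(X>x)\le P(Y>x)$ for all $x\in\mathbb R$. For $\underline a,\underline b\in\mathbb R^n$ with increasing rearrangements $a_{1:n}\le\cdots\le a_{n:n}$ and $b_{1:n}\le\cdots\le b_{n:n}$, $\underline a$ is weakly supermajorized by $\underline b$, written $\underline a\prec^{w}\underline b$, if $\sum_{i=1}^k a_{i:n}\ge\sum_{i=1}^k b_{i:n}$ for all $k=1,\dots,n$. *)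

(* Defs.v *)
From HB Require Import structures.
From mathcomp Require Import all_boot all_order all_algebra.
From mathcomp Require Import all_classical all_reals all_analysis.
From mathcomp Require Import measurable_realfun.

Set Implicit Arguments.
Unset Strict Implicit.
Unset Printing Implicit Defensive.
Import Order.TTheory GRing.Theory Num.Theory.
Import numFieldNormedType.Exports.
Local Open Scope classical_set_scope.
Local Open Scope ring_scope.

(* Cdf of W-Exp(alpha, beta, gamma): the Weibull-G cdf
   1 - exp (- alpha (F / (1 - F)) ^ beta) at F = 1 - exp (- gamma x), whose
   odds ratio F / (1 - F) is exp (gamma x) - 1. *)
Definition wexp_cdf (R : realType) (alpha beta gamma x : R) : R :=
  if 0 < x then 1 - expR (- (alpha * (expR (gamma * x) - 1) `^ beta)) else 0.

Definition has_wexp_dist d (T : measurableType d) (R : realType)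
    (P : probability T R) (X : {RV P >-> R}) (alpha beta gamma : R) : Prop :=
  forall x : R, cdf X x = (wexp_cdf alpha beta gamma x)%:E.

(* The product rule is required for every subfamily J. *)
Definition mutually_independent d (T : measurableType d) (R : realType)
    (P : probability T R) (I : finType) (X : I -> {RV P >-> R}) : Prop :=
  forall (J : {set I}) (B : I -> set R),
    (forall i, i \in J -> measurable (B i)) ->
    P (\bigcap_(i in [set` J]) (X i @^-1` B i)) =
    (\prod_(i in J) P (X i @^-1` B i))%E.

Section sample_maximum.
Context d (T : measurableType d) (R : realType) (P : probability T R) (n : nat).
Variable X : 'I_n.+1 -> {RV P >-> R}.

(* The default X ord0 w of the iterated maximum is itself one of its terms. *)
Definition sample_max_fun (w : T) : R :=
  \big[Num.max/X ord0 w]_(i < n.+1) X i w.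

Let measurable_sample_max_fun : measurable_fun setT sample_max_fun.
Proof.
rewrite /sample_max_fun.
elim: (index_enum _) => [|i s IHs].
  under eq_fun do rewrite big_nil; exact: measurable_funPT.
under eq_fun do rewrite big_cons.
apply: (measurable_maxr (f := X i)) => //; exact: measurable_funPT.
Qed.

HB.instance Definition _ :=
  isMeasurableFun.Build _ _ _ _ sample_max_fun measurable_sample_max_fun.

Definition sample_max : {RV P >-> R} := sample_max_fun.

End sample_maximum.

(* The two variables may live on different probability spaces. *)
Definition st_le (R : realType)
    d (T : measurableType d) (P : probability T R) (X : {RV P >-> R})
    d' (T' : measurableType d') (Q : probability T' R) (Y : {RV Q >-> R}) :
    Prop :=
  forall x : R, (ccdf X x <= ccdf Y x)%E.

Definition increasing_rearrangement (R : realType) (n : nat) (a : 'I_n -> R) :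
    seq R :=
  sort <=%R [seq a i | i : 'I_n].

Definition weakly_supermajorized (R : realType) (n : nat) (a b : 'I_n -> R) :
    Prop :=
  forall k : nat, (1 <= k <= n)%N ->
    \sum_(0 <= i < k) (increasing_rearrangement b)`_i <=
    \sum_(0 <= i < k) (increasing_rearrangement a)`_i.

(* Main.v *)
Require Import Defs.
From mathcomp Require Import all_boot all_order all_algebra.
From mathcomp Require Import all_classical all_reals all_analysis.
From mathcomp Require Import ring lra.
Import Order.TTheory GRing.Theory Num.Theory.
Import numFieldNormedType.Exports.
Local Open Scope ring_scope.

(** On x > 0 the log-cdf of the maximum is the sum over i of h (gamma_i x), where
    h t = m (ln alpha + beta ln (e^t - 1)) and m z = ln (1 - exp (- e^z)).
    Both m and t |-> ln (e^t - 1) are increasing and concave, hence so is h, with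
    slope c t = beta (u / (e^u - 1)) / (1 - e^-t), u = alpha (e^t - 1) ^ beta.
    Comparing sorted parameters through the tangents of h leaves the sum of
    c_i (gamma_i - gamma'_i) with c_i nonnegative and decreasing, which Abel
    summation turns into a nonnegative combination of the partial sums
    controlled by weak supermajorization. *)

(** * Weak supermajorization and sums of concave functions *)

Lemma abel_sum_ge0 {R : realDomainType} (n : nat) (c d : nat -> R) :
    (forall i, (i < n)%N -> 0 <= c i) ->
    (forall i, (i.+1 < n)%N -> c i.+1 <= c i) ->
    (forall k, (1 <= k <= n)%N -> 0 <= \sum_(0 <= i < k) d i) ->
  0 <= \sum_(0 <= i < n) c i * d i.
Proof.
move=> c_ge0 c_dec d_ge0; case: n => [|n] in c_ge0 c_dec d_ge0 *.
  by rewrite big_nil.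
(* Abel summation as an induction: lowering the coefficient from [c m] to [c m.+1] can only shrink
   its product with a nonnegative partial sum of [d], so the lower bound carries over. *)
suff partial m : (m < n.+1)%N ->
    c m * (\sum_(0 <= i < m.+1) d i) <= \sum_(0 <= i < m.+1) c i * d i.
  by apply: le_trans (partial n _); rewrite ?mulr_ge0 ?c_ge0 ?d_ge0 /=.
elim: m => [|m IHm] lt_mn; first by rewrite !big_nat1.
rewrite !(@big_nat_recr _ _ _ m.+1 0) //= mulrDr lerD2r.
apply: le_trans (IHm (ltnW lt_mn)).
by rewrite ler_wpM2r ?c_dec // d_ge0 //= ltnW.
Qed.

Lemma sum_increasing_rearrangement {R : realType} (n : nat) (a : 'I_n -> R)
    (h : R -> R) :
  \sum_i h (a i) =
  \sum_(0 <= i < n) h ((increasing_rearrangement a)`_i).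
Proof.
have size_a : size (increasing_rearrangement a) = n.
  by rewrite size_sort size_map size_enum_ord.
transitivity (\sum_(x <- increasing_rearrangement a) h x).
  have perm_a : perm_eq (increasing_rearrangement a) [seq a i | i : 'I_n].
    by rewrite perm_sort.
  by rewrite (perm_big _ perm_a) /= big_image.
by rewrite (big_nth 0) size_a.
Qed.

(** Concavity of [h] enters through its supergradient [c]. Tangents are taken at the sorted entries
    of [a], along which [c] decreases, as Abel summation requires. *)
Lemma weakly_supermajorized_sum_le {R : realType} (n : nat) (a b : 'I_n -> R)
    (h c : R -> R) :
    (forall i, 0 < a i) -> (forall i, 0 < b i) ->
    (forall x, 0 < x -> 0 <= c x) ->
    (forall x y, 0 < x -> x <= y -> c y <= c x) ->
    (forall x y, 0 < x -> 0 < y -> h y - h x <= c x * (y - x)) ->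
    weakly_supermajorized a b ->
  \sum_i h (b i) <= \sum_i h (a i).
Proof.
move=> a_gt0 b_gt0 c_ge0 c_dec tangent maj.
rewrite !sum_increasing_rearrangement -subr_ge0 -sumrB.
have rearr_gt0 (e : 'I_n -> R) i : (forall j, 0 < e j) -> (i < n)%N ->
    0 < (increasing_rearrangement e)`_i.
  move=> e_gt0 lt_in.
  have : (increasing_rearrangement e)`_i \in increasing_rearrangement e.
    by rewrite mem_nth // size_sort size_map size_enum_ord.
  by rewrite mem_sort => /mapP[j _ ->].
set s := increasing_rearrangement a in rearr_gt0 *.
set t := increasing_rearrangement b in rearr_gt0 *.
have : 0 <= \sum_(0 <= i < n) c s`_i * (s`_i - t`_i).
  apply: abel_sum_ge0 => [i lt_in | i lt_in | k kn].
  - by rewrite c_ge0 ?rearr_gt0.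
  - apply: c_dec; first by rewrite rearr_gt0 // ltnW.
    have size_s : size s = n by rewrite size_sort size_map size_enum_ord.
    have /(sortedP 0) : sorted <=%R s by rewrite sort_sorted //; exact: le_total.
    by apply; rewrite size_s.
  - by rewrite sumrB subr_ge0 maj.
move/le_trans; apply; apply: ler_sum_nat => i /= lt_in.
have := tangent _ _ (rearr_gt0 a i a_gt0 lt_in) (rearr_gt0 b i b_gt0 lt_in).
by rewrite -/s -/t; lra.
Qed.

(** * Tangent inequalities for the elementary functions *)

Lemma antitone_derivative_tangent {R : realType} (f df : R -> R) :
    (forall x : R, is_derive x 1 f (df x)) ->
    (forall x y, x <= y -> df y <= df x) ->
  forall x y, f y - f x <= df x * (y - x).
Proof.
move=> f_df df_dec x y.
have mvt a b : a < b -> exists2 c, c \in `]a, b[ & f b - f a = df c * (b - a).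
  move=> lt_ab; apply: MVT => //.
  apply: derivable_within_continuous => z _.
  by have [] := f_df z.
case: (ltgtP x y) => [lt_xy | lt_yx | ->]; last by rewrite !subrr mulr0.
- have [c + ->] := mvt _ _ lt_xy; rewrite in_itv /= => /andP[lt_xc _].
  by rewrite ler_wpM2r ?df_dec ?subr_ge0 ?ltW.
- have [c + eq_c] := mvt _ _ lt_yx; rewrite in_itv /= => /andP[_ lt_cx].
  have := df_dec _ _ (ltW lt_cx).
  nra.
Qed.

(** Write ln (e^t - 1) = t + ln (1 - e^-t). The bound then follows from ln q <= q - 1 at the ratio
    of the two values of 1 - e^-t, together with e^(a - b) >= 1 + (a - b). *)
Lemma ln_expR_sub1_tangent {R : realType} {a b : R} : 0 < a -> 0 < b ->
  ln (expR b - 1) - ln (expR a - 1) <= (b - a) / (1 - expR (- a)).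
Proof.
have split_ln t : 0 < t -> ln (expR t - 1) = t + ln (1 - expR (- t)).
  move=> t_gt0; rewrite -{2}(expRK t) -lnM ?posrE ?expR_gt0 ?subr_gt0 ?expR_lt1 //.
    by rewrite mulrBr mulr1 expRxMexpNx_1.
  by rewrite oppr_lt0.
move=> a_gt0 b_gt0; rewrite !split_ln //.
have Da : 0 < 1 - expR (- a) by rewrite subr_gt0 expR_lt1 oppr_lt0.
have Db : 0 < 1 - expR (- b) by rewrite subr_gt0 expR_lt1 oppr_lt0.
have q_gt0 : 0 < (1 - expR (- b)) / (1 - expR (- a)) by rewrite divr_gt0.
have ln_le : ln (1 - expR (- b)) - ln (1 - expR (- a)) <=
    (1 - expR (- b)) / (1 - expR (- a)) - 1.
  rewrite -ln_div ?posrE //.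
  set q := _ / _ in q_gt0 *.
  have := @le_ln1Dx R (q - 1).
  by rewrite (addrC 1) subrK; apply; lra.
have exp_le : expR (- a) * (1 + (a - b)) <= expR (- b).
  rewrite -[in leRHS](addKr a (- b)) expRD ler_pM2l ?expR_gt0 //.
  exact: expR_ge1Dx.
rewrite -(ler_pM2r Da) divfK ?gt_eqF //.
rewrite -(ler_pM2r Da) [leRHS]mulrBl divfK ?gt_eqF // in ln_le.
nra.
Qed.

(** Once the denominators are cleared, e^v >= e^u (1 + v - u) bounds the gap below by (v - u) (1 -
    e^u (1 - u)), which is nonnegative since 1 - u <= e^-u. *)
Lemma div_expR_sub1_antitone {R : realType} (u v : R) : 0 < u -> u <= v ->
  v / (expR v - 1) <= u / (expR u - 1).
Proof.
move=> u_gt0 le_uv; have v_gt0 : 0 < v := lt_le_trans u_gt0 le_uv.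
rewrite ler_pdivrMr ?subr_gt0 ?expR_gt1 // mulrAC.
rewrite ler_pdivlMr ?subr_gt0 ?expR_gt1 //.
have expv : expR u * (1 + (v - u)) <= expR v.
  rewrite -[in leRHS](subrKC u v) expRD ler_pM2l ?expR_gt0 //.
  exact: expR_ge1Dx.
have exp0 : expR u * (1 - u) <= 1.
  rewrite -[leRHS](expRxMexpNx_1 u) ler_pM2l ?expR_gt0 //.
  exact: expR_ge1Dx.
nra.
Qed.

(** The slope is the derivative in [z]; it is u / (e^u - 1) at u = e^z, hence antitone. *)
Lemma ln_one_sub_expRN_expR_tangent {R : realType} (z w : R) :
  ln (1 - expR (- expR w)) - ln (1 - expR (- expR z)) <=
  expR z / (expR (expR z) - 1) * (w - z).
Proof.
pose m (x : R) := ln (1 - expR (- expR x)).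
pose dm (x : R) := expR x / (expR (expR x) - 1).
apply: (@antitone_derivative_tangent R m dm) => [x | x y le_xy]; last first.
  by apply: div_expR_sub1_antitone; rewrite ?expR_gt0 ?ler_expR.
have pos : 0 < 1 - expR (- expR x).
  by rewrite subr_gt0 expR_lt1 oppr_lt0 expR_gt0.
have dln := is_derive1_ln pos.
have dinner : is_derive x 1 (fun y : R => 1 - expR (- expR y))
    (0 - expR (- expR x) * - expR x).
  exact: is_deriveB.
have := @is_derive1_comp _ _ (fun y => 1 - expR (- expR y)) _ _ _ dln dinner.
move/is_derive_eq; apply.
rewrite sub0r !mulrN opprK mulrA mulrC; congr (_ * _).
(* With exp (- e^x) written as an inverse, both sides are rational in exp (e^x) and [field]
   applies. *)
rewrite expRN in pos *.
field.
by rewrite !gt_eqF ?subr_gt0 ?expR_gt1 ?expR_gt0.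
Qed.

(** * Monotonicity and concavity of the log-cdf in gamma *)

Definition wexp_cumhazard {R : realType} (alpha beta gamma x : R) : R :=
  alpha * (expR (gamma * x) - 1) `^ beta.

(** The derivative of [ln (wexp_cdf alpha beta gamma x)] in [gamma]. *)
Definition log_wexp_cdf_slope {R : realType} (alpha beta x gamma : R) : R :=
  let u := wexp_cumhazard alpha beta gamma x in
  u / (expR u - 1) * (beta * (x / (1 - expR (- (gamma * x))))).

Section wexp_parameter.
Context {R : realType} {alpha beta x : R}.
Hypotheses (alpha_gt0 : 0 < alpha) (beta_gt0 : 0 < beta) (x_gt0 : 0 < x).

Let expR_sub1_gt0 g : 0 < g -> 0 < expR (g * x) - 1.
Proof. by move=> g_gt0; rewrite subr_gt0 expR_gt1 mulr_gt0. Qed.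

Let one_sub_expRN_gt0 g : 0 < g -> 0 < 1 - expR (- (g * x)).
Proof. by move=> g_gt0; rewrite subr_gt0 expR_lt1 oppr_lt0 mulr_gt0. Qed.

Lemma wexp_cumhazard_gt0 {g} : 0 < g -> 0 < wexp_cumhazard alpha beta g x.
Proof. by move=> g_gt0; rewrite mulr_gt0 ?powR_gt0 ?expR_sub1_gt0. Qed.

Lemma wexp_cumhazard_le {g1 g2} : 0 < g1 -> g1 <= g2 ->
  wexp_cumhazard alpha beta g1 x <= wexp_cumhazard alpha beta g2 x.
Proof.
move=> g1_gt0 le_g; have g2_gt0 := lt_le_trans g1_gt0 le_g.
rewrite ler_pM2l //; apply: ge0_ler_powR; first exact: ltW.
- by rewrite nnegrE ltW ?expR_sub1_gt0.
- by rewrite nnegrE ltW ?expR_sub1_gt0.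
by rewrite lerD2r ler_expR ler_pM2r.
Qed.

Lemma wexp_cdf_gt0 {g} : 0 < g -> 0 < wexp_cdf alpha beta g x.
Proof.
move=> g_gt0; rewrite /wexp_cdf x_gt0 subr_gt0 expR_lt1 oppr_lt0.
exact: wexp_cumhazard_gt0.
Qed.

Lemma log_wexp_cdf_slope_ge0 {g} : 0 < g ->
  0 <= log_wexp_cdf_slope alpha beta x g.
Proof.
move=> g_gt0; have u_gt0 := wexp_cumhazard_gt0 g_gt0.
apply/ltW/mulr_gt0; first by rewrite divr_gt0 ?subr_gt0 ?expR_gt1.
by rewrite mulr_gt0 ?divr_gt0 ?one_sub_expRN_gt0.
Qed.

Lemma log_wexp_cdf_slope_antitone {g1 g2} : 0 < g1 -> g1 <= g2 ->
  log_wexp_cdf_slope alpha beta x g2 <= log_wexp_cdf_slope alpha beta x g1.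
Proof.
move=> g1_gt0 le_g; have g2_gt0 := lt_le_trans g1_gt0 le_g.
have u2_gt0 := wexp_cumhazard_gt0 g2_gt0.
apply: ler_pM.
- by apply/ltW; rewrite divr_gt0 ?subr_gt0 ?expR_gt1.
- by apply/ltW; rewrite mulr_gt0 ?divr_gt0 ?one_sub_expRN_gt0.
- apply: div_expR_sub1_antitone; first exact: wexp_cumhazard_gt0.
  exact: wexp_cumhazard_le.
- rewrite !ler_pM2l // lef_pV2 ?posrE ?one_sub_expRN_gt0 //.
  by rewrite lerD2l lerN2 ler_expR lerN2 ler_pM2r.
Qed.

Lemma log_wexp_cdf_tangent {g1 g2} : 0 < g1 -> 0 < g2 ->
  ln (wexp_cdf alpha beta g2 x) - ln (wexp_cdf alpha beta g1 x) <=
  log_wexp_cdf_slope alpha beta x g1 * (g2 - g1).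
Proof.
move=> g1_gt0 g2_gt0.
(* [L] is the log of the cumulative hazard, so the cdf is 1 - exp (- e^(L g)). The outer tangent is
   taken at [L g1]; its slope is positive, so the tangent bound for [L] can be inserted into it. *)
pose L g := ln alpha + beta * ln (expR (g * x) - 1).
have expL g : 0 < g -> wexp_cumhazard alpha beta g x = expR (L g).
  move=> g_gt0; rewrite /L expRD lnK ?posrE // /wexp_cumhazard /powR.
  by rewrite gt_eqF ?expR_sub1_gt0.
rewrite /log_wexp_cdf_slope /wexp_cdf x_gt0.
rewrite -!/(wexp_cumhazard _ _ _ _) !expL //.
apply: le_trans (ln_one_sub_expRN_expR_tangent _ _) _.
rewrite -[leRHS]mulrA ler_pM2l ?divr_gt0 ?subr_gt0 ?expR_gt1 ?expR_gt0 //.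
have -> : L g2 - L g1 =
    beta * (ln (expR (g2 * x) - 1) - ln (expR (g1 * x) - 1)).
  by rewrite /L; ring.
rewrite -[leRHS]mulrA ler_pM2l //.
apply: le_trans (ln_expR_sub1_tangent _ _) _; rewrite ?mulr_gt0 //.
by rewrite -mulrBl [leRHS]mulrC [leRHS]mulrA.
Qed.

End wexp_parameter.

(** * Comparison of the two maxima *)

Lemma prod_wexp_cdf_le {R : realType} {n : nat} {alpha beta x : R}
    {gamma gamma' : 'I_n.+1 -> R} :
    0 < alpha -> 0 < beta ->
    (forall i, 0 < gamma i) -> (forall i, 0 < gamma' i) ->
    weakly_supermajorized gamma gamma' ->
  \prod_i wexp_cdf alpha beta (gamma' i) x <=
  \prod_i wexp_cdf alpha beta (gamma i) x.
Proof.
move=> alpha_gt0 beta_gt0 gamma_gt0 gamma'_gt0 maj.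
have [x_gt0 | x_le0] := ltP 0 x; last first.
  (* Every factor is 0 on both sides, so the products coincide. *)
  by rewrite /wexp_cdf ltNge x_le0 /=.
have prodE (g : 'I_n.+1 -> R) : (forall i, 0 < g i) ->
    \prod_i wexp_cdf alpha beta (g i) x =
    expR (\sum_i ln (wexp_cdf alpha beta (g i) x)).
  move=> g_gt0; rewrite expR_sum; apply: eq_bigr => i _.
  by rewrite lnK // posrE wexp_cdf_gt0.
rewrite [leLHS](prodE _ gamma'_gt0) [leRHS](prodE _ gamma_gt0) ler_expR.
apply: (@weakly_supermajorized_sum_le R n.+1 gamma gamma'
  (fun g => ln (wexp_cdf alpha beta g x)) (log_wexp_cdf_slope alpha beta x)) => //.
- exact: log_wexp_cdf_slope_ge0.
- exact: log_wexp_cdf_slope_antitone.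
- exact: log_wexp_cdf_tangent.
Qed.

Lemma cdf_sample_max {d} {T : measurableType d} {R : realType}
    {P : probability T R} {n : nat} {X : 'I_n.+1 -> {RV P >-> R}} (x : R) :
  mutually_independent X -> cdf (sample_max X) x = (\prod_i cdf (X i) x)%E.
Proof.
move=> X_indep.
have indep := X_indep [set: 'I_n.+1]%SET (fun=> `]-oo, x]%classic)
  (fun _ _ => measurable_itv _).
rewrite [RHS](eq_bigl (mem [set: 'I_n.+1]%SET)); last by move=> i; rewrite !inE.
rewrite /cdf /distribution /pushforward /= -indep; congr (P _).
apply/seteqP; split=> w /=; rewrite in_itv /= /sample_max_fun.
- move=> max_le i _ /=; rewrite in_itv /=.
  exact: le_trans (le_bigmax _ _ _) max_le.
(* The default of the iterated maximum must be bounded as well; it is [X ord0 w], so the bound at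
   [ord0] serves. *)
- move=> le_x; apply/bigmax_leP; split=> [|i _].
    by have := le_x ord0; rewrite /= in_itv /=; apply; rewrite inE.
  by have := le_x i; rewrite /= in_itv /=; apply; rewrite inE.
Qed.

Theorem theorem5 (R : realType) (n : nat)
    (dX dY : measure_display)
    (TX : measurableType dX) (TY : measurableType dY)
    (PX : probability TX R) (PY : probability TY R)
    (X : 'I_n.+1 -> {RV PX >-> R}) (Y : 'I_n.+1 -> {RV PY >-> R})
    (alpha beta : R) (gamma gamma' : 'I_n.+1 -> R)
    (alpha_gt0 : 0 < alpha) (beta_gt0 : 0 < beta)
    (gamma_gt0 : forall i, 0 < gamma i) (gamma'_gt0 : forall i, 0 < gamma' i)
    (X_indep : mutually_independent X) (Y_indep : mutually_independent Y)
    (X_dist : forall i, has_wexp_dist (X i) alpha beta (gamma i))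
    (Y_dist : forall i, has_wexp_dist (Y i) alpha beta (gamma' i))
    (gamma_maj : weakly_supermajorized gamma gamma') :
  st_le (sample_max X) (sample_max Y).
Proof.
(* Complements reverse the order: the cdf of the maximum of [Y] has to lie below that of [X]. *)
move=> x; rewrite !ccdf_1_cdf; apply: leeB; first exact: lexx.
rewrite (cdf_sample_max x Y_indep) (eq_bigr _ (fun i _ => Y_dist i x)).
rewrite (cdf_sample_max x X_indep) (eq_bigr _ (fun i _ => X_dist i x)).
rewrite [leLHS]prodEFin [leRHS]prodEFin lee_fin.
exact: prod_wexp_cdf_le.
Qed.
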